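(* Let $G_1$ and $G_2$ be transitive permutation groups on a finite set $\Omega$ with $G_1\le G_2$. If $G_1$ is pre-primitive, then $G_2$ is pre-primitive.
   Context: A permutation group on $\Omega$ is a subgroup of $\mathrm{Sym}(\Omega)$. A partition of $\Omega$ is $G$-invariant if every $g\in G$ maps each part onto a part. The orbit partition of a subgroup $H\le G$ is the partition of $\Omega$ into $H$-orbits. A transitive permutation group $G$ on a finite set $\Omega$ is pre-primitive if every $G$-invariant partition of $\Omega$ is the orbit partition of some subgroup of $G$. *)

(* Defs.v *)
From mathcomp Require Import all_boot all_fingroup.

Set Implicit Arguments.
Unset Strict Implicit.
Unset Printing Implicit Defensive.

Import GroupScope.

Section PrePrimitive.

Variable T : finType.
Implicit Types (G H : {group {perm T}}) (P : {set {set T}}).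

(* The action 'P^* of {perm T} on {set T} is the image action, so the second
   conjunct says that every g in G maps each part of P onto a part of P. *)
Definition invariant_partition G P : bool :=
  partition P [set: T] && [acts G, on P | 'P^*].

Definition orbit_partition H : {set {set T}} := orbit 'P H @: [set: T].

(* As for MathComp's primitivity, transitivity is part of the notion. *)
Definition preprimitive G : bool :=
  [transitive G, on [set: T] | 'P] &&
  [forall P, invariant_partition G P ==>
    [exists H : {group {perm T}},
      (H \subset G) && (P == orbit_partition H)]].

End PrePrimitive.

(* Main.v *)
Require Import Defs.
From mathcomp Require Import all_boot all_fingroup.

Set Implicit Arguments.
Unset Strict Implicit.
Unset Printing Implicit Defensive.

Import GroupScope.

(** Enlarging the group weakens pre-primitivity's demand at both ends: the
    larger group has fewer invariant partitions ([invariant_partitionS]) and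
    more subgroups whose orbits may realise them. So a subgroup of [G1] that
    realises a [G2]-invariant partition already serves for [G2]. *)

Lemma invariant_partitionS (T : finType) (G1 G2 : {group {perm T}})
    (P : {set {set T}}) :
  G1 \subset G2 -> invariant_partition G2 P -> invariant_partition G1 P.
Proof.
move=> sG12 /andP[partP actP].
by rewrite /invariant_partition partP (subset_trans sG12 actP).
Qed.

Theorem theorem1p3 (T : finType) (G1 G2 : {group {perm T}})
    (trG1 : [transitive G1, on [set: T] | 'P])
    (trG2 : [transitive G2, on [set: T] | 'P])
    (sG12 : G1 \subset G2) :
  preprimitive G1 -> preprimitive G2.
Proof.
case/andP=> _ /forallP realG1; rewrite /preprimitive trG2 /=.
apply/forallP=> P; apply/implyP=> /(invariant_partitionS sG12) invP.
have /existsP[H /andP[sHG1 defP]] := implyP (realG1 P) invP.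
by apply/existsP; exists H; rewrite (subset_trans sHG1 sG12).
Qed.
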